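(* Let $G(d,k)$ be the Cayley tree with branching factor $d$ and height $k$, where $d^k=n$, with source the root and an artificial sink attached to all vertices of level $k$. Let $\omega=\omega(n)\to\infty$ slowly with $n$. With high probability (probability tending to $1$ as $n\to\infty$) the finish time $t_f$ of DLA on $G(d,k)$ satisfies $T_f/\omega\le t_f\le\omega T_f$, where $T_f$ is as follows. (1) If $d\to\infty$, $k\to\infty$ and $d\ll k$ (i.e. $d/k\to0$), then $T_f=\sqrt{k}\; d^{\,k+3/2-\sqrt{2k+2}}$. (2) If $d\ge2$ is constant, then $T_f=\sqrt{k}\; d^{\,k-\sqrt{2k}}$.
   Context: The Cayley tree $G(d,k)$ is the rooted tree with levels $0,1,\dots,k$ in which every vertex at level $i<k$ has exactly $d$ children at level $i+1$; level $k$ has $d^k=n$ vertices. The source $v$ is the root (level $0$) and the sink $z$ is an additional vertex (level $k+1$) adjacent to all vertices of level $k$. DLA process: initially (step $t=0$) only $z$ is occupied. At each step $t=1,2,\dots$ an independent random walk is run from $v$ to $z$, moving from each vertex to a uniformly random child (and from level $k$ to $z$): $v=x_0x_1\cdots x_kx_{k+1}=z$. If $x_i$ ($i\ge1$) is the first occupied vertex on the walk, the particle halts at $x_{i-1}$ and permanently occupies it. The process ends at the finish time $t_f$, the first step at which the source $v$ is occupied. ''$\omega\to\infty$ slowly'' means that $\omega=\omega(n)$ is any quantity tending to infinity with $n$, suitably slowly. *)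

(* Defs.v *)
From HB Require Import structures.
From mathcomp Require Import all_boot all_order all_algebra finmap.
From mathcomp Require Import all_classical all_reals all_analysis.

Set Implicit Arguments.
Unset Strict Implicit.
Unset Printing Implicit Defensive.

Import Order.TTheory GRing.Theory Num.Theory.

(* A vertex of the tree at level [i] is the word, of length [i <= k], of the
   child indices read from the root; [None] is the sink. *)
Definition vertex (d k : nat) : finType := option (k.-bseq 'I_d).

Definition source {d k : nat} : vertex d k := Some [bseq].

Definition sink {d k : nat} : vertex d k := None.

(* [c] lists the child chosen at each of the levels 0, ..., k-1; the walk stays
   at the sink from index k+1 on. *)
Definition walk (d k : nat) (c : k.-tuple 'I_d) (i : nat) : vertex d k :=
  if i <= k then Some (take_bseq i c) else sink.

Lemma walk0 (d k : nat) (c : k.-tuple 'I_d) : walk c 0 = source.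
Proof. by congr Some; apply: val_inj; rewrite /= take0. Qed.

Lemma walk_child (d k : nat) (c : k.-tuple 'I_d) (i : 'I_k) (u v : k.-bseq 'I_d) :
  walk c i = Some u -> walk c i.+1 = Some v -> v = rcons u (tnth c i) :> seq _.
Proof.
rewrite /walk ltn_ord ltnW //= => -[<-] [<-] /=.
by rewrite (tnth_nth (tnth c i)) (take_nth (tnth c i)) ?size_tuple.
Qed.

Lemma walk_sink (d k : nat) (c : k.-tuple 'I_d) : walk c k.+1 = sink.
Proof. by rewrite /walk ltnn. Qed.

(* [find] returns the least [j <= k] such that the vertex of index [j + 1] of
   the walk is occupied: the particle halts at the vertex of index [j]. *)
Definition halt (d k : nat) (O : {set vertex d k}) (c : k.-tuple 'I_d) :
    vertex d k :=
  walk c (find (fun j => walk c j.+1 \in O) (iota 0 k.+1)).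

(* Once the source is occupied the process has ended and nothing changes. *)
Definition dla_step (d k : nat) (O : {set vertex d k}) (c : k.-tuple 'I_d) :
    {set vertex d k} :=
  if source \in O then O else halt O c |: O.

(* The walk of step [t.+1] follows the choices [c t]. *)
Fixpoint occupied (d k : nat) (c : nat -> k.-tuple 'I_d) (t : nat) :
    {set vertex d k} :=
  if t is t'.+1 then dla_step (occupied c t') (c t') else [set sink].

Lemma sink_occupied (d k : nat) (c : nat -> k.-tuple 'I_d) (t : nat) :
  sink \in occupied c t.
Proof.
elim: t => [|t IHt] /=; first by rewrite inE.
by rewrite /dla_step; case: ifP => // _; rewrite inE IHt orbT.
Qed.

Lemma halt_free (d k : nat) (O : {set vertex d k}) (c : k.-tuple 'I_d) :
  sink \in O -> source \notin O -> halt O c \notin O.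
Proof.
move=> Osink Osource; rewrite /halt.
set p := fun j => _; case Ej: (find p (iota 0 k.+1)) => [|j].
  by rewrite walk0.
have hp : has p (iota 0 k.+1).
  by apply/hasP; exists k; rewrite ?mem_iota ?add0n ?leqnn // /p walk_sink.
have ltj : j < find p (iota 0 k.+1) by rewrite Ej.
have := before_find 0 ltj; rewrite nth_iota ?add0n /p => [->//|].
by apply: leq_trans ltj _; rewrite -[X in _ <= X](size_iota 0) find_size.
Qed.

Lemma source_occupied (d k : nat) (c : nat -> k.-tuple 'I_d) :
  exists t, source \in occupied c t.
Proof.
pose N := #|vertex d k|.
suff H t : (source \in occupied c t) || (t < #|occupied c t|).
  by exists N; have := H N; rewrite ltnNge max_card orbF.
elim: t => [|t IHt]; first by rewrite cards1 orbT.
rewrite /= /dla_step; case: ifP => [-> //|nS].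
move: IHt; rewrite nS /= => IHt.
by rewrite cardsU1 halt_free ?sink_occupied ?nS // add1n ltnS IHt orbT.
Qed.

Definition finish_time (d k : nat) (c : nat -> k.-tuple 'I_d) : nat :=
  ex_minn (source_occupied c).

Local Open Scope classical_set_scope.
Local Open Scope ring_scope.

(* A random variable with values in a finite set carrying its power set as
   sigma-algebra.  [{RV P >-> 'I_n}] is not available: measurable types are
   pointed, hence nonempty. *)
Definition finite_random_variable d (T : measurableType d) (F : finType)
    (X : T -> F) : Prop :=
  forall A : set F, measurable (X @^-1` A).

Definition uniformly_distributed d (T : measurableType d) (R : realType)
    (P : probability T R) (F : finType) (X : T -> F) : Prop :=
  forall a : F, P (X @^-1` [set a]) = (#|F|%:R^-1)%:E.

Definition mutually_independent d (T : measurableType d) (R : realType)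
    (P : probability T R) (I : choiceType) (F : finType) (X : I -> T -> F) :
    Prop :=
  forall (J : {fset I}) (A : I -> set F),
    P (\bigcap_(i in [set` J]) X i @^-1` A i) =
    (\prod_(i <- J) P (X i @^-1` A i))%E.

(* [C (t, i)] is the index of the child to which the walk of step [t.+1] moves
   from level [i]. *)
Definition uniform_walks d0 (T : measurableType d0) (R : realType)
    (P : probability T R) (d k : nat) (C : nat * 'I_k -> T -> 'I_d) : Prop :=
  [/\ forall ti, finite_random_variable (C ti),
      forall ti, uniformly_distributed P (C ti)
    & mutually_independent P C].

Definition dla_finish_time (T : Type) (d k : nat)
    (C : nat * 'I_k -> T -> 'I_d) (x : T) : nat :=
  finish_time (fun t => [tuple C (t, i) x | i < k]).

Definition growing_branching_time (R : realType) (d k : nat) : R :=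
  Num.sqrt k%:R * d%:R `^ (k%:R + 3 / 2 - Num.sqrt (2 * k%:R + 2)).

Definition constant_branching_time (R : realType) (d k : nat) : R :=
  Num.sqrt k%:R * d%:R `^ (k%:R - Num.sqrt (2 * k%:R)).

(* Main.v *)
Require Import Defs.
From mathcomp Require Import all_boot all_order all_algebra finmap.
From mathcomp Require Import all_classical all_reals all_analysis.
From mathcomp Require Import ring lra zify.
Import Order.TTheory GRing.Theory Num.Theory.
Import numFieldNormedType.Exports.

Set Implicit Arguments.
Unset Strict Implicit.
Unset Printing Implicit Defensive.

Local Open Scope ring_scope.

(** Why the theorem is true.

    Both bounds hold with constant factors: if T denotes the time of the
    growing-branching case, then T / 8 <= t_f <= 32 T with probability tending
    to 1, uniformly over 2 <= d <= k ([finish_time_concentrated]).  For constant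
    d the two formulas for T_f differ by a factor between 1 and d ^ 2.

    A vertex of level i - 1 becomes occupied only when a walk passes through an
    occupied vertex of level i.  So the source is reached through a chain of
    walks, one for the leaf and then one per level, each through an ancestor of
    the leaf.  After t steps the expected number of chains that lead from the
    leaves to level k - j is the binomial of t over j + 1, divided by
    d ^ (k + (k-1) + ... + (k-j+1)).  It is smallest for j close to
    sqrt (2k+2) - 1, and this bottleneck determines T.  Let l be the integer
    with l (l+1) / 2 <= k < (l+1) (l+2) / 2; then q = l + 1 is the integer
    nearest to sqrt (2k+2), and with D = d ^ (k + 3/2 - sqrt (2k+2)) the
    power D ^ q equals d ^ (k + ... + (k-l+1)) up to a factor
    d ^ ((q - sqrt (2k+2)) ^ 2 / 2), which lies between 1 and d
    ([scale_exp_ge], [scale_exp_le]).  Since q! ^ (1/q) is of order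
    sqrt k, the critical time is sqrt k * D = T.

    Lower bound: before the source is occupied some vertex of level k - l must
    be, and for t <= T / 8 the expected number of these is at most d / 2 ^ q
    ([source_occupied_le], [early_bound]).

    Upper bound: the time is cut into k + 1 phases, and only chains are counted
    that use one walk of each phase: the first phase supplies the leaf, the next
    one passes through level k, the one after it through level k - 1, and so on.
    Phases are independent, and read backwards in time they build a branching
    structure from the root to the leaves, whose first two moments obey a
    recursion ([chain_weight_mean], [chain_weight_sqr]).  The second moment
    method bounds the failure probability by the quantity [loss]
    ([source_unoccupied_le]).  With q phases of length between 4 D and 8 D for
    the levels above k - l and the leaves, and phases q times shorter for the lower levels, which are
    easily filled, the total time is at most 32 T and the loss is exponentially
    small in q ([sumn_phases], [loss_phases]).

    Probabilities of events that depend on the first t walks are averages over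
    all lists of t walks ([history_event]), so both moment computations take
    place in finite sums. *)

(** * Averages over lists of independent draws *)

Section Averages.
Variables (R : realFieldType) (W : finType).
Implicit Types (f g h : W -> R) (F G : seq W -> R).

Definition avg f : R := #|W|%:R^-1 * \sum_c f c.

(** Expectation over [n] independent uniform draws.  The lists are read with the
    latest draw at the head, the order in which the state of the process is a
    right fold. *)
Fixpoint avgs n F : R :=
  if n is n'.+1 then avg (fun c => avgs n' (fun s => F (c :: s))) else F [::].

Lemma eq_avg f g : f =1 g -> avg f = avg g.
Proof. by move=> fg; rewrite /avg (eq_bigr g). Qed.

Lemma ler_avg f g : (forall c, f c <= g c) -> avg f <= avg g.
Proof. by move=> fg; rewrite /avg ler_wpM2l ?invr_ge0 ?ler_sum. Qed.

Lemma avgD f g : avg (fun c => f c + g c) = avg f + avg g.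
Proof. by rewrite /avg big_split mulrDr. Qed.

Lemma avgZ a f : avg (fun c => a * f c) = a * avg f.
Proof. by rewrite /avg -mulr_sumr mulrCA. Qed.

Lemma avg_sum (I : Type) (r : seq I) (P : pred I) (f : I -> W -> R) :
  avg (fun c => \sum_(i <- r | P i) f i c) = \sum_(i <- r | P i) avg (f i).
Proof. by rewrite /avg exchange_big mulr_sumr. Qed.

Lemma eq_avgs n F G : (forall s, size s = n -> F s = G s) -> avgs n F = avgs n G.
Proof.
elim: n F G => [|n IH] F G FG /=; first exact: FG.
by apply: eq_avg => c; apply: IH => s sz; apply: FG; rewrite /= sz.
Qed.

Lemma ler_avgs n F G :
  (forall s, size s = n -> F s <= G s) -> avgs n F <= avgs n G.
Proof.
elim: n F G => [|n IH] F G FG /=; first exact: FG.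
by apply: ler_avg => c; apply: IH => s sz; apply: FG; rewrite /= sz.
Qed.

Lemma avgs_cat m n F :
  avgs (m + n) F = avgs m (fun p => avgs n (fun s => F (p ++ s))).
Proof. by elim: m F => //= m IH F; apply: eq_avg => c; rewrite IH. Qed.

Lemma avgsD n F G : avgs n (fun s => F s + G s) = avgs n F + avgs n G.
Proof.
elim: n F G => //= n IH F G.
by rewrite -avgD; apply: eq_avg => c; rewrite IH.
Qed.

Lemma avgsZ n a F : avgs n (fun s => a * F s) = a * avgs n F.
Proof.
elim: n F => //= n IH F.
by rewrite -avgZ; apply: eq_avg => c; rewrite IH.
Qed.

Lemma avgs_avg n (F : seq W -> W -> R) :
  avgs n (fun s => avg (F s)) = avg (fun c => avgs n (F^~ c)).
Proof.
elim: n F => //= n IH F.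
under eq_avg => c do rewrite IH.
rewrite /avg; congr (_ * _); rewrite -mulr_sumr exchange_big mulr_sumr.
by apply: eq_bigr => c _.
Qed.

(** Conditioning on the earlier draws rather than on the latest one. *)
Lemma avgsS n F : avgs n.+1 F = avgs n (fun s => avg (fun c => F (c :: s))).
Proof. by rewrite avgs_avg. Qed.

Hypothesis W_gt0 : (0 < #|W|)%N.

Lemma avg_cst a : avg (fun=> a) = a.
Proof.
by rewrite /avg sumr_const -[a *+ _]mulr_natl mulKf ?pnatr_eq0 -?lt0n.
Qed.

Lemma avgs_cst n a : avgs n (fun=> a) = a.
Proof. by elim: n => //= n ->; exact: avg_cst. Qed.

Lemma avgs_sum n h : avgs n (fun s => \sum_(c <- s) h c) = n%:R * avg h.
Proof.
elim: n => [|n IH]; first by rewrite /= big_nil mul0r.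
rewrite avgsS.
under eq_avgs => s _.
  under eq_avg => c do rewrite big_cons.
  rewrite avgD avg_cst; over.
by rewrite avgsD avgs_cst IH -natr1; ring.
Qed.

(** The [n] diagonal pairs contribute the second moment of [h], the
    [n * (n - 1)] pairs of distinct draws contribute its squared mean. *)
Lemma avgs_sum_sqr n h : avgs n (fun s => (\sum_(c <- s) h c) ^+ 2) =
  n%:R * avg (fun c => h c ^+ 2) + n%:R * (n%:R - 1) * avg h ^+ 2.
Proof.
elim: n => [|n IH]; first by rewrite /= big_nil; ring.
rewrite avgsS.
rewrite (@eq_avgs _ _ (fun s => avg (fun c => h c ^+ 2) +
  ((2 * avg h) * \sum_(c <- s) h c + (\sum_(c <- s) h c) ^+ 2))) => [|s _].
  by rewrite !avgsD avgs_cst avgsZ avgs_sum IH -natr1; ring.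
rewrite -[X in _ = _ + (_ + X)]avg_cst mulrAC -avgZ -!avgD.
by apply: eq_avg => c; rewrite big_cons; ring.
Qed.

End Averages.

(** * Prefixes of walks *)

Section Prefixes.
Variables (R : realFieldType) (d k : nat).
Local Notation W := (k.-tuple 'I_d).

Lemma card_prefix (u : seq 'I_d) : (size u <= k)%N ->
  #|[pred c : W | take (size u) c == u]| = (d ^ (k - size u))%N.
Proof.
move=> uk; have E : (size u + (k - size u) = k)%N by rewrite subnKC.
pose f (s : (k - size u).-tuple 'I_d) : W := tcast E (cat_tuple (in_tuple u) s).
have vf s : f s = u ++ s :> seq _ by rewrite val_tcast.
have f_inj : injective f.
  by move=> s s' /(congr1 (@tval _ _)) /eqP; rewrite !vf eqseq_cat // => /andP[_ /eqP/val_inj].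
have <- : #|{: (k - size u).-tuple 'I_d}| = (d ^ (k - size u))%N.
  by rewrite card_tuple card_ord.
rewrite -(card_codom f_inj).
apply: eq_card => c; rewrite !inE; apply/eqP/codomP => [cu|[s ->]]; last first.
  by rewrite -[f s : seq _]/(tval (f s)) vf take_size_cat.
have sz : size (drop (size u) c) == (k - size u)%N by rewrite size_drop size_tuple.
exists (Tuple sz); apply/val_inj.
by rewrite -[RHS]/(tval _) vf -[LHS](cat_take_drop (size u) c) cu.
Qed.

Hypothesis d_gt0 : (0 < d)%N.

Lemma card_walks_gt0 : (0 < #|{: W}|)%N.
Proof. by rewrite card_tuple card_ord expn_gt0 d_gt0. Qed.

Lemma avg_prefix (u : seq 'I_d) : (size u <= k)%N ->
  avg (fun c : W => (take (size u) c == u)%:R) = ((d ^ size u)%:R)^-1 :> R.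
Proof.
move=> uk; rewrite /avg -natr_sum -big_mkcond sum1_card card_prefix //.
rewrite card_tuple card_ord -[in X in X^-1](subnK uk) expnD natrM invfM.
by rewrite mulrC mulrA mulfV ?mul1r // pnatr_eq0 -lt0n expn_gt0 d_gt0.
Qed.

(** Truncating the prefix length at [k] lets one formula serve the levels
    [0, ..., k] and the sink, which a walk reaches in [k + 1] moves. *)
Lemma avg_same_prefix L (c : W) :
  avg (fun c' : W => (take L c' == take L c)%:R) = ((d ^ minn L k)%:R)^-1 :> R.
Proof.
have E (c' : W) : take L c' = take (minn L k) c'.
  have [Lk|kL] := leqP L k; first by [].
  by rewrite !take_oversize // size_tuple // ltnW.
have sz : size (take (minn L k) c) = minn L k.
  by rewrite size_take_min size_tuple -minnA minnn.
rewrite -[in RHS]sz -avg_prefix ?sz ?geq_minr //.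
by apply: eq_avg => c'; rewrite !E.
Qed.

End Prefixes.

(** * Growth of the cluster along a list of walks *)

Section Dynamics.
Variables (d k : nat).
Local Notation W := (k.-tuple 'I_d).
Implicit Types (O : {set vertex d k}) (c : W) (s p : seq W).

(** The head of [s] is the latest walk, as in [avgs]. *)
Definition run s O : {set vertex d k} := foldr (fun c O => dla_step O c) O s.

Lemma run_cat p s O : run (p ++ s) O = run p (run s O).
Proof. by rewrite /run foldr_cat. Qed.

Lemma dla_step_sub O c : O \subset dla_step O c.
Proof. by rewrite /dla_step; case: ifP => // _; rewrite subsetU1. Qed.

Lemma run_sub s O : O \subset run s O.
Proof. by elim: s => //= c s /fintype.subset_trans; apply; exact: dla_step_sub. Qed.

Definition blocked L c O := exists2 i, (i <= L)%N & walk c i \in O.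

Lemma blocked_sub L c O O' : O \subset O' -> blocked L c O -> blocked L c O'.
Proof. by move=> /fintype.subsetP sub [i iL Oi]; exists i; rewrite ?sub. Qed.

Lemma walk_eq_prefix L c c' i : (i <= L)%N -> take L c = take L c' -> walk c i = walk c' i.
Proof.
move=> iL E; rewrite /walk; case: ifP => // _; congr Some; apply: val_inj => /=.
by rewrite -(take_takel c iL) E take_takel.
Qed.

Lemma blocked_prefix L c c' O :
  take L c = take L c' -> blocked L c O -> blocked L c' O.
Proof. by move=> E [i iL Oi]; exists i; rewrite // -(walk_eq_prefix iL E). Qed.

(** The particle of a walk that meets the cluster at level [L + 1] or lower halts
    at level [L] or lower, on the walk itself.  If the source is already occupied
    the walk is blocked at level [0]. *)
Lemma blocked_step L c O : (L <= k)%N -> blocked L.+1 c O -> blocked L c (dla_step O c).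
Proof.
move=> Lk [[|j] jL Oj].
  by exists 0%N => //; apply: (fintype.subsetP (dla_step_sub O c)).
rewrite /dla_step; case: ifP => [Os|_]; first by exists 0%N; rewrite // walk0.
rewrite /halt; set p := fun j => _; exists (find p (iota 0 k.+1)); last first.
  by rewrite setU11.
apply: leq_trans (jL : (j <= L)%N); rewrite leqNgt; apply/negP => lt_j.
have jk : (j < k.+1)%N by exact: leq_trans jL _.
by have := before_find 0%N lt_j; rewrite nth_iota // /p add0n Oj.
Qed.

Lemma blocked_run L c c' p O : (L <= k)%N -> c' \in p ->
  take L.+1 c' = take L.+1 c -> blocked L.+1 c O -> blocked L c' (run p O).
Proof.
move=> Lk; case/splitPr => p1 p2 E bl.
rewrite -cat_rcons -cats1 -catA run_cat.
apply: (blocked_sub (run_sub _ _)).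
rewrite run_cat /=; apply: blocked_step => //.
apply: (blocked_sub (run_sub _ _)).
by apply: blocked_prefix bl.
Qed.

End Dynamics.

(** * Second moment of the number of chains *)

Section SecondMoment.
Variables (R : realFieldType) (d k : nat).
Hypothesis d_gt0 : (0 < d)%N.
Local Notation W := (k.-tuple 'I_d).
Implicit Types (O : {set vertex d k}) (c : W) (s p : seq W) (f : W -> R).

Definition prefix_determined L f := forall c c', take L c = take L c' -> f c = f c'.

(** Weights of chains read backwards in time, from the root.  A walk [c'] of the
    phase [p] that agrees with [c] up to level [L] carries the weight [f c'],
    and every chain that ends with [c'] is extended by [c].  The factor is the
    inverse of the expected number of such [c'] in a phase of [m] walks, so that
    averages keep their mean. *)
Definition spread L m p f c : R :=
  (d ^ minn L k)%:R / m%:R * \sum_(c' <- p) (take L c' == take L c)%:R * f c'.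

Lemma spread_determined L m p f : prefix_determined L (spread L m p f).
Proof. by move=> c c' E; rewrite /spread E. Qed.

Let dn L : (d ^ L)%:R != 0 :> R.
Proof. by rewrite pnatr_eq0 -lt0n expn_gt0 d_gt0. Qed.

Lemma avg_spread L m p f :
  avg (spread L m p f) = m%:R^-1 * \sum_(c <- p) f c.
Proof.
rewrite /spread avgZ avg_sum.
have E (c' : W) : avg (fun c : W => (take L c' == take L c)%:R * f c') =
    ((d ^ minn L k)%:R)^-1 * f c'.
  under eq_avg => c do rewrite mulrC eq_sym.
  by rewrite avgZ avg_same_prefix // mulrC.
under eq_bigr do rewrite E.
by rewrite -mulr_sumr mulrA [_ / m%:R]mulrC mulfK.
Qed.

Lemma avgs_spread L m f : (0 < m)%N ->
  avgs m (fun p => avg (spread L m p f)) = avg f.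
Proof.
move=> m0; under eq_avgs => p _ do rewrite avg_spread.
rewrite avgsZ avgs_sum ?card_walks_gt0 // mulKf //.
by rewrite pnatr_eq0 -lt0n.
Qed.

Lemma avgs_spread_sqr L m f : (0 < m)%N ->
  avgs m (fun p => avg (spread L m p f) ^+ 2) <=
  avg f ^+ 2 + m%:R^-1 * avg (fun c => f c ^+ 2).
Proof.
move=> m0; have mn : m%:R != 0 :> R by rewrite pnatr_eq0 -lt0n.
under eq_avgs => p _ do rewrite avg_spread exprMn.
rewrite avgsZ avgs_sum_sqr ?card_walks_gt0 //.
have -> : m%:R^-1 ^+ 2 * (m%:R * avg (fun c => f c ^+ 2) +
    m%:R * (m%:R - 1) * avg f ^+ 2) =
  avg f ^+ 2 + m%:R^-1 * avg (fun c => f c ^+ 2) - m%:R^-1 * avg f ^+ 2.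
  by field.
by rewrite gerBl mulr_ge0 ?invr_ge0 // sqr_ge0.
Qed.

(** For a fixed [c] the walks counted by [spread] all have weight [f c], so only
    the number of walks through one vertex fluctuates; that number has
    expectation [m / d ^ L.+1]. *)
Lemma avgs_avg_spread_sqr L m f : (0 < m)%N -> prefix_determined L f ->
  avgs m (fun p => avg (fun c => spread L.+1 m p f c ^+ 2)) <=
  (1 + (d ^ minn L.+1 k)%:R / m%:R) * avg (fun c => f c ^+ 2).
Proof.
move=> m0 fL; have mn : m%:R != 0 :> R by rewrite pnatr_eq0 -lt0n.
rewrite avgs_avg -avgZ; apply: ler_avg => c.
set D : R := (d ^ _)%:R.
have Dn : D != 0 := dn _.
pose e c' : R := (take L.+1 c' == take L.+1 c)%:R.
rewrite (@eq_avgs _ _ _ _ (fun p => (D / m%:R * f c) ^+ 2 * (\sum_(c' <- p) e c') ^+ 2)) => [|p _].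
  rewrite avgsZ avgs_sum_sqr ?card_walks_gt0 //.
  have -> : avg (fun c' => e c' ^+ 2) = avg e.
    by apply: eq_avg => c'; rewrite /e; case: eqP => _; rewrite ?expr1n ?expr0n.
  rewrite /e avg_same_prefix // -/D.
  rewrite (_ : _ * _ = (1 + D / m%:R) * f c ^+ 2 - m%:R^-1 * f c ^+ 2).
    by rewrite gerBl mulr_ge0 ?invr_ge0 // sqr_ge0.
  by field; rewrite Dn mn.
rewrite -exprMn -[_ * f c * _]mulrA /spread -/D; congr ((_ * _) ^+ 2).
rewrite mulr_sumr; apply: eq_bigr => c' _; rewrite /e mulrC.
case: eqP => [E|_]; last by rewrite !mulr0.
congr (_ * _); apply: fL.
by rewrite -(take_takel c (leqnSn L)) -E take_takel.
Qed.

(** A bound for the variance of the number of chains relative to its squared mean,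
    for phases of lengths [ms] that treat the levels after [L].  A phase of
    length [m] adds the sampling error [m^-1] of the mean and amplifies the
    remaining error by the relative second moment of the number of visits to a
    vertex. *)
Fixpoint loss L (ms : seq nat) : R :=
  if ms is m :: ms' then
    m%:R^-1 + (1 + (d ^ minn L.+1 k)%:R / m%:R) * loss L.+1 ms'
  else 0.

Lemma loss_ge0 L ms : 0 <= loss L ms.
Proof.
elim: ms L => //= m ms IH L.
by rewrite addr_ge0 ?invr_ge0 // mulr_ge0 // addr_ge0 // divr_ge0.
Qed.

(** The normalized number of chains that take one walk from each block of [s],
    where the blocks have lengths [ms].  The last block is the earliest phase: its
    walks need only reach the sink at level [k + 1]. *)
Fixpoint chain_weight L (ms : seq nat) f s : R :=
  if ms is m :: ms' then
    chain_weight L.+1 ms' (spread L.+1 m (take m s) f) (drop m s)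
  else avg f.

Lemma avgs_chain_weight (phi : R -> R) L m ms f :
  avgs (sumn (m :: ms)) (fun s => phi (chain_weight L (m :: ms) f s)) =
  avgs m (fun p => avgs (sumn ms)
    (fun s => phi (chain_weight L.+1 ms (spread L.+1 m p f) s))).
Proof.
rewrite [sumn _]/= avgs_cat; apply: eq_avgs => p sp.
by apply: eq_avgs => s _; rewrite /= take_size_cat ?drop_size_cat.
Qed.

Lemma chain_weight_mean L ms f : all (leq 1) ms ->
  avgs (sumn ms) (chain_weight L ms f) = avg f.
Proof.
elim: ms L f => // m ms IH L f /andP[m0 ms0].
rewrite (avgs_chain_weight id).
by under eq_avgs => p _ do rewrite IH //; exact: avgs_spread.
Qed.

Lemma chain_weight_sqr L ms f : all (leq 1) ms -> prefix_determined L f ->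
  avgs (sumn ms) (fun s => chain_weight L ms f s ^+ 2) <=
  avg f ^+ 2 + loss L ms * avg (fun c => f c ^+ 2).
Proof.
elim: ms L f => [|m ms IH] L f; first by rewrite /= mul0r addr0.
move=> /andP[m0 ms0] fL; rewrite (avgs_chain_weight (fun x => x ^+ 2)).
apply: (le_trans (ler_avgs (fun p _ => IH _ _ ms0 (@spread_determined L.+1 m p f)))).
rewrite avgsD avgsZ /=.
apply: (le_trans (lerD (avgs_spread_sqr _ _ m0)
  (ler_wpM2l (loss_ge0 _ _) (avgs_avg_spread_sqr m0 fL)))).
by rewrite le_eqVlt; apply/orP; left; apply/eqP; ring.
Qed.

(** What a nonzero weight means for the process: once the cluster blocks [c] at
    level [L], the later walks [p] carry it to the source. *)
Definition leads_to_source L f p := forall c O,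
  f c != 0 -> blocked L c O -> source \in run p O.

Lemma leads_to_source_spread L m f p p' : (L <= k)%N -> leads_to_source L f p ->
  leads_to_source L.+1 (spread L.+1 m p' f) (p ++ p').
Proof.
move=> Lk lead c O nz bl; rewrite run_cat.
suff /hasP[c' c'p /andP[/eqP E nz']] :
    has (fun c' => (take L.+1 c' == take L.+1 c) && (f c' != 0)) p'.
  exact/(lead c')/(blocked_run Lk c'p E).
apply: contraNT nz => /hasPn no; rewrite /spread big_seq big1 ?mulr0 // => c' c'p.
move/negbTE: (no c' c'p); case: eqP => _ /=; last by rewrite mul0r.
by move=> /negbFE/eqP->; rewrite mulr0.
Qed.

(** The induction ends at level [k + 1], where the sink blocks every walk. *)
Lemma chain_weight_source L ms f p s : (L + size ms = k.+1)%N ->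
  leads_to_source L f p -> chain_weight L ms f s != 0 -> size s = sumn ms ->
  source \in run (p ++ s) [set sink].
Proof.
elim: ms L f p s => [|m ms IH] L f p s /= Lms lead nz sz.
  rewrite (size0nil sz) cats0; rewrite addn0 in Lms.
  suff [c nzc] : exists c, f c != 0.
    by apply: (lead c _ nzc); exists k.+1; rewrite ?Lms // walk_sink inE.
  apply/existsP; apply: contraNT nz; rewrite negb_exists => /forallP f0.
  by rewrite /avg big1 ?mulr0 // => c _; apply/eqP; rewrite -[_ == _]negbK f0.
rewrite -[s](cat_take_drop m) catA; apply: (IH L.+1) nz _; first by rewrite addSnnS.
  apply: leads_to_source_spread lead.
  by rewrite -ltnS -Lms addnS ltnS leq_addr.
by rewrite size_drop sz addKn.
Qed.

(** Second moment method: the normalized number of chains has mean [1], and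
    where it vanishes its squared deviation from the mean is [1]. *)
Lemma source_unoccupied_le ms : size ms = k.+1 -> all (leq 1) ms ->
  avgs (sumn ms) (fun s : seq W => (source \notin run s [set sink])%:R) <= loss 0 ms.
Proof.
move=> sz ms0; pose X s := chain_weight 0 ms (fun=> 1) s.
apply: (@le_trans _ _ (avgs (sumn ms) (fun s => 1 + (-2 * X s + X s ^+ 2)))).
  apply: ler_avgs => s ss; rewrite (_ : 1 + _ = (1 - X s) ^+ 2); last by ring.
  case: (boolP (_ \in _)) => [_|/=]; first exact: sqr_ge0.
  apply: contraNT; rewrite -ltNge => lt1.
  apply: (@chain_weight_source 0 ms (fun=> 1) [::]) => //; last first.
    by apply: contraTneq lt1; rewrite -/(X s) => ->; rewrite subr0 expr1n ltxx.
  by move=> c O _ [i]; rewrite leqn0 => /eqP->; rewrite walk0.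
rewrite 2!avgsD avgsZ avgs_cst ?card_walks_gt0 // /X chain_weight_mean //.
have := @chain_weight_sqr 0 ms (fun=> 1) ms0 (fun _ _ _ => erefl).
rewrite (@eq_avg _ _ (fun=> 1 ^+ 2) (fun=> 1)) ?avg_cst ?card_walks_gt0 //; last first.
  by move=> c; rewrite expr1n.
by rewrite expr1n; lra.
Qed.

End SecondMoment.

(** * First moment of the level counts *)

Section FirstMoment.
Variables (R : realFieldType) (d k : nat).
Hypothesis d_gt0 : (0 < d)%N.
Local Notation W := (k.-tuple 'I_d).
Implicit Types (O : {set vertex d k}) (c : W) (s : seq W).

Definition at_level i (v : vertex d k) := if v is Some u then size u == i else false.

Definition count_level i O := #|[set v in O | at_level i v]|.

Lemma at_level_walk i c j : (i <= k)%N -> at_level i (walk c j) = (j == i).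
Proof.
move=> ik; rewrite /walk; case: ifP => [jk|/negbT]; last first.
  by rewrite -ltnNge => /(leq_ltn_trans ik)/gtn_eqF->.
by rewrite /= size_take_min size_tuple (minn_idPl jk).
Qed.

Lemma halt_next O c : sink \in O ->
  let j := find (fun j => walk c j.+1 \in O) (iota 0 k.+1) in walk c j.+1 \in O.
Proof.
move=> Osink; set p := fun j => _; rewrite /=; set j := find _ _.
have hp : has p (iota 0 k.+1).
  by apply/hasP; exists k; rewrite ?mem_iota ?add0n ?leqnn // /p walk_sink.
have := nth_find 0%N hp; rewrite nth_iota ?add0n //.
by move: hp; rewrite has_find size_iota.
Qed.

Lemma count_level_step i O c : (i <= k)%N -> sink \in O ->
  (count_level i (dla_step O c) <= count_level i O + (walk c i.+1 \in O))%N.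
Proof.
move=> ik Osink; rewrite /dla_step; case: ifP => _; first exact: leq_addr.
have := halt_next c Osink; rewrite /halt; set j := find _ _ => /= Oj.
have [ij|nij] := eqVneq j i; last first.
  suff -> : count_level i (walk c j |: O) = count_level i O by exact: leq_addr.
  apply: eq_card => v; rewrite !inE; case: eqP => [->|//].
  by rewrite at_level_walk // (negbTE nij) !andbF.
rewrite -ij Oj addn1 /count_level.
apply: (@leq_trans #|walk c j |: [set v in O | at_level j v]|).
  by apply/subset_leq_card/fintype.subsetP => v; rewrite !inE; case: eqP.
by rewrite cardsU1 -add1n leq_add2r leq_b1.
Qed.

Lemma sink_run s : sink \in run s [set sink : vertex d k].
Proof. by apply: (fintype.subsetP (run_sub _ _)); rewrite inE. Qed.

(** A vertex of a level [j < k] is occupied only by a walk blocked at level [j + 1],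
    so the occupied levels form an interval ending at [k]. *)
Lemma count_level_gt0 i s : (i <= k)%N -> source \in run s [set sink : vertex d k] ->
  (0 < count_level i (run s [set sink]))%N.
Proof.
move=> ik src.
have next j : (j < k)%N -> (0 < count_level j (run s [set sink]))%N ->
    (0 < count_level j.+1 (run s [set sink]))%N.
  move=> jk; elim: s {src} => [|c s IH] /=.
    case/card_gt0P => v; rewrite !inE => /andP[/eqP->].
    by [].
  set O := run s _ in IH *.
  move=> /leq_trans/(_ (count_level_step c (ltnW jk) (sink_run s))).
  rewrite addn_gt0 => H; apply: (@leq_trans (count_level j.+1 O)); last first.
    apply/subset_leq_card/fintype.subsetP => v; rewrite !inE => /andP[Ov ->].
    by rewrite (fintype.subsetP (dla_step_sub O c)).
  case/orP: H => [//|]; rewrite lt0b => Ow.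
  by apply/card_gt0P; exists (walk c j.+1); rewrite inE Ow at_level_walk ?eqxx.
elim: i ik => [_|i IH ik]; last by apply: next => //; apply/IH/ltnW.
by apply/card_gt0P; exists source; rewrite inE src.
Qed.

Lemma avg_walk_in i O : (i <= k)%N ->
  avg (fun c => (walk c i \in O)%:R) = (count_level i O)%:R / (d ^ i)%:R :> R.
Proof.
move=> ik.
rewrite (@eq_avg _ _ _ (fun c => \sum_(v in [set v in O | at_level i v]) (walk c i == v)%:R)).
  rewrite avg_sum (eq_bigr (fun=> ((d ^ i)%:R)^-1)) => [|v].
    by rewrite sumr_const mulr_natl.
  rewrite inE => /andP[_]; case: v => [u /eqP ui|//].
  rewrite -ui -(@avg_prefix R d k d_gt0 u) ?ui //; apply: eq_avg => c.
  by rewrite /walk ik; congr (nat_of_bool _)%:R;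
    apply/eqP/eqP => [[<-]//|E]; congr Some; apply/val_inj.
move=> c; case: (boolP (_ \in O)) => Ow; last first.
  rewrite big1 // => v; rewrite inE => /andP[Ov _].
  by case: eqP => // E; rewrite E Ov in Ow.
rewrite (bigD1 (walk c i)) /=; last by rewrite inE Ow at_level_walk ?eqxx.
rewrite eqxx big1 ?addr0 // => v /andP[_]; by rewrite eq_sym => /negbTE->.
Qed.

(** A walk hits level [k - j + 1] of the cluster with probability equal to the
    occupied fraction of that level, so the expectations satisfy Pascal's rule up
    to the factors [d ^ (k - i)]. *)
Lemma avgs_count_level j t : (j <= k)%N ->
  avgs t (fun s : seq W => (count_level (k - j)%N (run s [set sink]))%:R) <=
  'C(t, j.+1)%:R / (d ^ \sum_(i < j) (k - i))%:R :> R.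
Proof.
elim: t j => [|t IH] j jk.
  rewrite bin0n /= mul0r (_ : count_level _ _ = 0%N) //.
  by apply: eq_card0 => v; rewrite !inE; case: eqP => // ->.
rewrite avgsS.
have step s : avg (fun c => (count_level (k - j)%N (run (c :: s) [set sink]))%:R) <=
    (count_level (k - j)%N (run s [set sink]))%:R +
    avg (fun c : W => (walk c (k - j)%N.+1 \in run s [set sink])%:R) :> R.
  rewrite -[X in X + _](@avg_cst R W) ?card_walks_gt0 // -avgD.
  apply: ler_avg => c; rewrite -natrD ler_nat.
  exact: (count_level_step c (leq_subr j k) (sink_run s)).
apply: (le_trans (ler_avgs (fun s _ => step s))); rewrite avgsD binS natrD mulrDl.
apply: lerD; first exact: IH.
case: j jk {step} => [|j] jk.
  rewrite subn0 bin0 big_ord0 expn0 divr1 -[leRHS](avgs_cst (card_walks_gt0 k d_gt0) t).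
  apply: ler_avgs => s _; rewrite -[leRHS](avg_cst (card_walks_gt0 k d_gt0)).
  by apply: ler_avg => c; rewrite lern1 leq_b1.
rewrite subnSK //.
under eq_avgs => s _ do rewrite avg_walk_in ?leq_subr // mulrC.
rewrite avgsZ big_ord_recr /= expnD natrM mulrC invfM mulrA.
by rewrite ler_wpM2r ?invr_ge0 // IH // ltnW.
Qed.

Lemma source_occupied_le j t : (j <= k)%N ->
  avgs t (fun s : seq W => (source \in run s [set sink])%:R) <=
  'C(t, j.+1)%:R / (d ^ \sum_(i < j) (k - i))%:R :> R.
Proof.
move=> jk; apply: le_trans (avgs_count_level t jk).
apply: ler_avgs => s _; rewrite ler_nat; case: (boolP (_ \in _)) => // src.
exact: count_level_gt0 (leq_subr _ _) src.
Qed.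

End FirstMoment.

(** * From the probability space to finite averages *)

Local Open Scope classical_set_scope.

Section Tuples.
Variables (R : realFieldType) (W : finType).

Lemma avgs_tuple n (F : seq W -> R) :
  avgs n F = (#|W|%:R ^+ n)^-1 * \sum_(w : n.-tuple W) F w.
Proof.
elim: n F => [|n IH] F.
  by rewrite expr0 invr1 mul1r (big_pred1 [tuple]) // => w; apply/esym/eqP; exact: tuple0.
rewrite /= (reindex (fun p : W * n.-tuple W => [tuple of p.1 :: p.2])) /=; last first.
  exists (fun w => (thead w, [tuple of behead w])) => [[c w] _|w _].
    by rewrite theadE; congr pair; apply: val_inj.
  by rewrite -tuple_eta.
rewrite -(pair_bigA _ (fun c (w : n.-tuple W) => F (c :: w))) /=.
under eq_avg => c do rewrite IH.
by rewrite avgZ /avg mulrA exprSr invfM [_ ^-1 * _^-1]mulrC.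
Qed.

End Tuples.

Section Transfer.
Context {R : realType} {disp : measure_display} {T : measurableType disp}.
Variables (P : probability T R) (d k : nat) (C : nat * 'I_k -> T -> 'I_d).
Hypothesis d_gt0 : (0 < d)%N.
Hypothesis walksC : uniform_walks P C.
Local Notation W := (k.-tuple 'I_d).

Fixpoint history (c : nat -> W) t : seq W :=
  if t is t'.+1 then c t' :: history c t' else [::].

Lemma size_history c t : size (history c t) = t.
Proof. by elim: t => //= t ->. Qed.

Lemma nth_history c0 c t s : (s < t)%N -> nth c0 (history c t) (t - s.+1) = c s.
Proof.
elim: t => // t IH; rewrite ltnS leq_eqVlt => /predU1P[->|st].
  by rewrite subnn.
by rewrite subSS -[in nth _ _ _](subnSK st) /= IH.
Qed.

Definition walks (x : T) (t : nat) : W := [tuple C (t, i) x | i < k].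

(** The cylinder is the intersection of [t * k] independent events of probability
    [1 / d], one for each move. *)
Lemma walks_cylinder (a : nat -> W) t :
  measurable [set x | forall s, (s < t)%N -> walks x s = a s] /\
  P [set x | forall s, (s < t)%N -> walks x s = a s] =
    ((#|{: W}|%:R ^+ t)^-1)%:E.
Proof.
have [mC uC iC] := walksC.
pose J := [fset p in [seq (s, i) | s <- iota 0 t, i <- enum 'I_k]]%fset.
pose A (p : nat * 'I_k) : set 'I_d := [set tnth (a p.1) p.2].
have JE s i : ((s, i) \in J) = (s < t)%N.
  rewrite inE; apply/allpairsP/idP => [[[s' i'] [/= + _ [-> _]]]|st].
    by rewrite mem_iota.
  by exists (s, i); rewrite mem_iota mem_enum.
have -> : [set x | forall s, (s < t)%N -> walks x s = a s] =
    \bigcap_(p in [set` J]) C p @^-1` A p.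
  apply/seteqP; split => x /= H.
    by move=> [s i] /=; rewrite JE => /H/(congr1 (fun w => tnth w i)); rewrite tnth_mktuple.
  move=> s st; apply: eq_from_tnth => i; rewrite tnth_mktuple.
  by apply: (H (s, i)); rewrite /= JE.
split; first by apply: fin_bigcap_measurable => [|p _]; [exact: finite_fset|exact: mC].
rewrite iC (eq_bigr (fun=> (d%:R^-1)%:E)) => [|p _]; last first.
  by rewrite /A uC card_ord.
rewrite prodEFin big_const_seq count_predT; congr EFin.
have -> : size J = (t * k)%N.
  rewrite -[size _]/(#|` J|%fset) card_fseq undup_id; last first.
    by rewrite allpairs_uniq ?iota_uniq ?enum_uniq // => -[? ?] [? ?].
  by rewrite size_allpairs size_iota size_enum_ord.
rewrite card_tuple card_ord -natrX -expnM natrX mulnC.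
by rewrite -exprVn; elim: (k * t)%N => //= n ->; rewrite exprS.
Qed.

Lemma history_point t (w : t.-tuple W) :
  measurable [set x | history (walks x) t = w] /\
  P [set x | history (walks x) t = w] = ((#|{: W}|%:R ^+ t)^-1)%:E.
Proof.
pose c0 : W := nseq_tuple k (Ordinal d_gt0).
have -> : [set x | history (walks x) t = w] =
    [set x | forall s, (s < t)%N -> walks x s = nth c0 w (t - s.+1)].
  apply/seteqP; split => x /= H.
    by move=> s st; rewrite -H nth_history.
  apply: (@eq_from_nth _ c0); first by rewrite size_history size_tuple.
  rewrite size_history => j jt.
  have jE : (t - (t - j.+1).+1 = j)%N by rewrite subnSK // subKn // ltnW.
  by rewrite -jE nth_history ?H // ltn_subrL (leq_ltn_trans _ jt).
exact: walks_cylinder.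
Qed.

(** Every event of this kind is a disjoint union of cylinders of equal probability,
    so the moment computations may take place in finite averages. *)
Lemma history_event t (Phi : seq W -> bool) :
  measurable [set x | Phi (history (walks x) t)] /\
  P [set x | Phi (history (walks x) t)] =
    (avgs t (fun s : seq W => (Phi s)%:R))%:E.
Proof.
pose F (w : t.-tuple W) := [set x | history (walks x) t = w].
pose Q := [pred w : t.-tuple W | Phi w].
have -> : [set x | Phi (history (walks x) t)] = \bigcup_(w in [set` Q]) F w.
  apply/seteqP; split => x /=.
    move=> H; have sz : size (history (walks x) t) == t by rewrite size_history.
    by exists (Tuple sz).
  by move=> [w /= Qw ->].
have finQ : finite_set [set` Q] by exact: finite_finset.
split; first by apply: fin_bigcup_measurable => // w _; case: (history_point w).
have tF : trivIset [set` Q] F.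
  by move=> w w' _ _ [x [/= E E']]; apply: val_inj; rewrite /= -E -E'.
rewrite measure_fin_bigcup //; last by move=> w _; case: (history_point w).
rewrite -(@bigfs _ _ _ _ (index_enum (t.-tuple W))) ?index_enum_uniq //; last first.
  by move=> w _; rewrite mem_index_enum.
rewrite (eq_bigr (fun=> ((#|{: W}|%:R ^+ t)^-1)%:E)) => [|w _]; last first.
  by case: (history_point w).
rewrite sumEFin avgs_tuple; congr EFin.
by rewrite big_mkcond mulr_sumr; apply: eq_bigr => w _ /=; case: ifP => _; rewrite ?mulr1 ?mulr0.
Qed.

Lemma occupied_history (c : nat -> W) t :
  occupied c t = run (history c t) [set sink].
Proof. by elim: t => //= t ->. Qed.

Lemma finish_time_le (c : nat -> W) t :
  (finish_time c <= t)%N = (source \in run (history c t) [set sink]).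
Proof.
have sub u v : (u <= v)%N -> occupied c u \subset occupied c v.
  elim: v => [|v IH]; first by rewrite leqn0 => /eqP->.
  rewrite leq_eqVlt => /orP[/eqP->//|uv].
  apply: (fintype.subset_trans (IH uv)); exact: dla_step_sub.
rewrite -occupied_history /finish_time; case: ex_minnP => m src min.
apply/idP/idP => [mt|]; [exact: (fintype.subsetP (sub _ _ mt))|exact: min].
Qed.

Lemma dla_finish_time_le t :
  P [set x | (dla_finish_time C x <= t)%N] =
  (avgs t (fun s : seq W => (source \in run s [set sink])%:R))%:E.
Proof.
rewrite -(history_event t (fun s => source \in run s [set sink])).2.
by congr (P _); apply/seteqP; split => x /=; rewrite finish_time_le.
Qed.

Lemma measurable_dla_finish_time_le t :
  measurable [set x | (dla_finish_time C x <= t)%N].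
Proof.
have [+ _] := history_event t (fun s => source \in run s [set sink]).
by congr (measurable _); apply/seteqP; split => x /=; rewrite finish_time_le.
Qed.

Lemma measurable_dla_finish_time (A : set nat) :
  measurable [set x | A (dla_finish_time C x)].
Proof.
have -> : [set x | A (dla_finish_time C x)] =
    \bigcup_(n in A) [set x | dla_finish_time C x = n].
  by apply/seteqP; split => x /= => [Ax|[n An ->]] //; exists (dla_finish_time C x).
apply: bigcup_measurable => -[|n] _.
  have -> : [set x | dla_finish_time C x = 0%N] = [set x | (dla_finish_time C x <= 0)%N].
    by apply/seteqP; split => x /=; rewrite leqn0 => /eqP.
  exact: measurable_dla_finish_time_le.
have -> : [set x | dla_finish_time C x = n.+1] =
    [set x | (dla_finish_time C x <= n.+1)%N] `\` [set x | (dla_finish_time C x <= n)%N].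
  apply/seteqP; split => x /=; first by move=> ->; rewrite ltnn.
  by move=> [+ /negP]; rewrite -ltnNge => le1 lt; apply/eqP; rewrite eqn_leq le1.
by apply: measurableD; exact: measurable_dla_finish_time_le.
Qed.

End Transfer.

(** * Elementary estimates *)

Section Estimates.
Variable R : realType.

Lemma prod_1D_le_expR (I : Type) (r : seq I) (P : pred I) (a : I -> R) :
  (forall i, P i -> 0 <= a i) ->
  \prod_(i <- r | P i) (1 + a i) <= expR (\sum_(i <- r | P i) a i).
Proof.
move=> a0; suff /andP[] :
    0 <= \prod_(i <- r | P i) (1 + a i) <= expR (\sum_(i <- r | P i) a i) by [].
apply: (big_ind2 (fun x y => 0 <= x <= expR y)) => [|x x' y y'|i Pi].
- by rewrite expR0 ler01 lexx.
- by move=> /andP[x0 xx] /andP[y0 yy]; rewrite expRD mulr_ge0 //= ler_pM.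
- by rewrite addr_ge0 ?a0 //= expR_ge1Dx.
Qed.

Lemma expR_half_le2 : expR (2^-1) <= 2 :> R.
Proof.
have := expR_ge1Dx (- 2^-1 : R); rewrite expRN.
have := expR_gt0 (2^-1 : R); set e := expR _ => e0 h.
have := ler_wpM2r (ltW e0) h; rewrite mulVf ?gt_eqF //; lra.
Qed.

(** The term [q ^ q / q!] of the exponential series of [q] is at most
    [expR q <= 4 ^ q]. *)
Lemma exprn_le_fact q : q%:R ^+ q <= 4 ^+ q * q`!%:R :> R.
Proof.
case: q => [|l]; first by rewrite !expr0 mul1r.
set q := l.+1.
have e4 : expR q%:R <= 4 ^+ q :> R.
  have -> : expR q%:R = (expR 2^-1 ^+ 2) ^+ q :> R.
    by rewrite -!expRM_natl; congr expR; field.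
  rewrite lerXn2r ?nnegrE ?exprn_ge0 ?expR_ge0 //.
  have := expR_half_le2; have := expR_gt0 (2^-1 : R); nra.
have := le_trans (expR_ge1Dxn l (ler0n R q)) e4.
move=> h; rewrite -ler_pdivrMr ?ltr0n ?fact_gt0 //; lra.
Qed.

Lemma bin_le_exprn t q : 'C(t, q)%:R <= t%:R ^+ q / q`!%:R :> R.
Proof.
rewrite ler_pdivlMr ?ltr0n ?fact_gt0 // -natrM -natrX ler_nat bin_ffact ffact_prod.
rewrite -[in leqRHS](card_ord q) -prod_nat_const.
by apply: leq_prod => i _; exact: leq_subr.
Qed.

Lemma sum_expn_lt d n : (2 <= d)%N -> (\sum_(i < n) d ^ i.+1 <= 2 * d ^ n)%N.
Proof.
move=> d2; elim: n => [|n IH]; first by rewrite big_ord0.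
rewrite big_ord_recr /= expnS [leqRHS]mul2n -addnn leq_add2r.
by apply: leq_trans IH _; rewrite leq_mul2r d2 orbT.
Qed.

Lemma sum_exprVn_le (d n : nat) : (2 <= d)%N ->
  \sum_(i < n) ((d ^ i)%:R)^-1 <= 2 :> R.
Proof.
move=> d2; apply: (@le_trans _ _ (2 - 2 * ((d ^ n)%:R)^-1)); last first.
  by rewrite gerBl mulr_ge0 // invr_ge0.
elim: n => [|n IH]; first by rewrite big_ord0 expn0; lra.
rewrite big_ord_recr /= expnS natrM invfM.
have x0 : 0 <= ((d ^ n)%:R)^-1 :> R by rewrite invr_ge0.
have dV : (d%:R)^-1 <= 2^-1 :> R by rewrite lef_pV2 ?posrE ?ltr0n ?ler_nat //; lia.
nra.
Qed.

(** Unfolding a block of equal phases: the amplification factors multiply, and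
    each sampling error is bounded as if it were amplified by all of them. *)
Lemma loss_nseq_cat d k L n m ms : (0 < m)%N -> (L + n <= k)%N ->
  loss R d k L (nseq n m ++ ms) <=
  \prod_(i < n) (1 + (d ^ (L + i).+1)%:R / m%:R) *
    (n%:R / m%:R + loss R d k (L + n) ms).
Proof.
move=> m0; elim: n L => [|n IH] L Ln; first by rewrite big_ord0 mul0r add0r addn0 mul1r.
rewrite /= big_ord_recl /= addn0 (minn_idPl _); last by lia.
have {IH} := IH L.+1; rewrite addSnnS => /(_ Ln).
have -> : \prod_(i < n) (1 + (d ^ (L + bump 0 i).+1)%:R / m%:R) =
    \prod_(i < n) (1 + (d ^ (L.+1 + i).+1)%:R / m%:R) :> R.
  by apply: eq_bigr => i _; rewrite /bump /= add1n addSnnS.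
set l := loss _ _ _ _ (nseq _ _ ++ _); set l' := loss _ _ _ _ _.
set p := \prod_(i < n) _; set a := (d ^ L.+1)%:R / m%:R => IH.
have a0 : 0 <= a by rewrite divr_ge0.
have p1 : 1 <= p.
  apply: (big_ind (fun x => 1 <= x)) => // [x y|i _]; first exact: mulr_ege1.
  by rewrite lerDl divr_ge0.
have -> : n.+1%:R / m%:R = n%:R / m%:R + m%:R^-1 :> R.
  by rewrite -natr1 mulrDl mul1r.
have v_le : m%:R^-1 <= (1 + a) * (p * m%:R^-1).
  by rewrite mulrA ler_peMl ?invr_ge0 // mulr_ege1 // lerDl.
have := lerD v_le (ler_wpM2l (addr_ge0 ler01 a0) IH).
by rewrite -mulrDr -mulrDr addrCA [_ + (_ + l')]addrA mulrA [m%:R^-1 + _]addrC.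
Qed.

End Estimates.

(** * The critical scale *)

Lemma sum_top_levels (R : realFieldType) (k l : nat) : (l <= k)%N ->
  (\sum_(i < l) (k - i))%:R = l%:R * k%:R - l%:R * (l%:R - 1) / 2 :> R.
Proof.
elim: l => [|j IH] jk; first by rewrite big_ord0; lra.
rewrite big_ord_recr /= natrD IH ?(ltnW jk) // natrB ?(ltnW jk) // -[j.+1%:R]natr1.
lra.
Qed.

Lemma root_le (k l : nat) : (l * l.+1 <= 2 * k < l.+1 * l.+2)%N -> (l <= k)%N.
Proof. nia. Qed.

Section Scale.
Variables (R : realType) (d k l : nat).
Hypothesis d_ge2 : (2 <= d)%N.
Hypothesis l_root : (l * l.+1 <= 2 * k < l.+1 * l.+2)%N.

(** The time [growing_branching_time] without its factor [sqrt k]: the length of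
    one phase, up to a constant. *)
Definition scale : R := d%:R `^ (k%:R + 3 / 2 - Num.sqrt (2 * k%:R + 2)).

Let s : R := Num.sqrt (2 * k%:R + 2).

Let sE : s ^+ 2 = 2 * k%:R + 2.
Proof. by rewrite /s sqr_sqrtr // addr_ge0 // mulr_ge0. Qed.

Let s_ge0 : 0 <= s. Proof. exact: sqrtr_ge0. Qed.

Let lR : l%:R * (l%:R + 1) <= 2 * k%:R :> R.
Proof. by rewrite natr1 -!natrM ler_nat; case/andP: l_root. Qed.

Let kR : 2 * k%:R + 2 <= (l%:R + 1) * (l%:R + 2) :> R.
Proof.
rewrite natr1 (_ : l%:R + 2 = l.+2%:R); last by rewrite -[l.+2]addn2 natrD.
have ev : (l.+1 * l.+2 = 2 * (l.+1 * l.+2)./2)%N.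
  by rewrite mul2n -[LHS]odd_double_half oddM /=; case: (odd l).
by rewrite -!natrM -natrD ler_nat ev; move: l_root; rewrite ev; lia.
Qed.

(* Equivalently, [l + 1] is the integer nearest to [s]. *)
Let s_ge : l%:R + 1 / 2 <= s.
Proof.
have l0 : 0 <= l%:R :> R by []; have := sE; have := s_ge0; have := lR; nra.
Qed.

Let s_le : s <= l%:R + 3 / 2.
Proof.
have l0 : 0 <= l%:R :> R by []; have := sE; have := s_ge0; have := kR; nra.
Qed.

Let d_ge1 : 1 <= d%:R :> R.
Proof. by rewrite ler1n ltnW. Qed.

Let powE n : (d ^ n)%:R = d%:R `^ n%:R :> R.
Proof. by rewrite natrX powR_mulrn. Qed.

Lemma scale_gt0 : 0 < scale.
Proof. by rewrite /scale powR_gt0 // ltr0n ltnW. Qed.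

(** [scale_ge] makes phases long enough to fill the levels up to [k - l], and
    [scale_le] keeps the expected number of visits to a vertex of a higher level
    bounded in each phase. *)
Lemma scale_ge : (d ^ (k - l))%:R <= scale.
Proof.
rewrite powE /scale -/s ler_powR // natrB ?(root_le l_root) //; have := s_le; lra.
Qed.

Lemma scale_le : scale <= (d ^ (k - l).+1)%:R.
Proof.
rewrite powE /scale -/s ler_powR // -[(k - l).+1%:R]natr1 natrB ?(root_le l_root) //.
have := s_ge; lra.
Qed.

(* Completing the square in the exponent, with [s ^+ 2 = 2 * k + 2]. *)
Let scale_expE : scale ^+ l.+1 =
  (d ^ \sum_(i < l) (k - i))%:R * d%:R `^ ((l%:R + 1 - s) ^+ 2 / 2).
Proof.
rewrite -powR_mulrn ?powR_ge0 // /scale -/s -powRrM powE -powRD; last first.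
  by rewrite pnatr_eq0 -lt0n ltnW ?implybT.
congr (_ `^ _); rewrite sum_top_levels ?(root_le l_root) // -natr1.
have := sE; lra.
Qed.

Lemma scale_exp_ge : (d ^ \sum_(i < l) (k - i))%:R <= scale ^+ l.+1.
Proof.
rewrite scale_expE ler_peMr // -[leLHS](powRr0 d%:R) ler_powR //.
by rewrite divr_ge0 // sqr_ge0.
Qed.

Lemma scale_exp_le : scale ^+ l.+1 <= d%:R * (d ^ \sum_(i < l) (k - i))%:R.
Proof.
rewrite scale_expE mulrC ler_wpM2r // -[leRHS]powRr1 // ler_powR //.
have := s_le; have := s_ge; nra.
Qed.

End Scale.

(** * Bounds on the two moments at the critical scale *)

Section Bounds.
Variables (R : realType) (d k l : nat).
Hypothesis d_ge2 : (2 <= d)%N.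
Hypothesis l_root : (l * l.+1 <= 2 * k < l.+1 * l.+2)%N.
Local Notation q := l.+1.
Local Notation D := (scale R d k).
Local Notation A := (\sum_(i < l) (k - i))%N.

Let k_le : (k <= q ^ 2)%N.
Proof. by move: l_root; nia. Qed.

Let sqrt_le : Num.sqrt k%:R <= q%:R :> R.
Proof.
rewrite -[leRHS](@ger0_norm R) ?ler0n // -sqrtr_sqr ler_sqrt ?sqr_ge0 //.
by rewrite -natrX ler_nat.
Qed.

Let D_gt0 : 0 < D := scale_gt0 R k d_ge2.

Let dA_gt0 : 0 < (d ^ A)%:R :> R.
Proof. by rewrite ltr0n expn_gt0 ltnW. Qed.

(** With [q = l + 1] and [D = scale R d k], the three ingredients are
    [sqrt k <= q], [q ^ q <= 4 ^ q q!] and [D ^ q <= d * d ^ A]; the constant [8]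
    beats the [4] and leaves [2 ^ q]. *)
Lemma early_bound t : t%:R <= Num.sqrt k%:R * D / 8 ->
  'C(t, q)%:R / (d ^ A)%:R <= d%:R / 2 ^+ q :> R.
Proof.
move=> tD; rewrite ler_pdivrMr //.
apply: le_trans (bin_le_exprn R t q) _.
have fact0 : 0 < q`!%:R :> R by rewrite ltr0n fact_gt0.
rewrite ler_pdivrMr //.
have t_le : t%:R ^+ q <= q%:R ^+ q * D ^+ q / 8 ^+ q.
  rewrite -exprMn -expr_div_n lerXn2r ?nnegrE // ?divr_ge0 ?mulr_ge0 ?(ltW D_gt0) //.
  by apply: le_trans tD _; rewrite ler_pM2r // ler_pM2r.
apply: le_trans t_le _.
have e8 : (8 : R) ^+ q = 4 ^+ q * 2 ^+ q.
  by rewrite -exprMn; congr (_ ^+ _); rewrite -natrM.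
have p4 : 0 < (4 : R) ^+ q by rewrite exprn_gt0.
have p2 : 0 < (2 : R) ^+ q by rewrite exprn_gt0.
have -> : d%:R / 2 ^+ q * (d ^ A)%:R * q`!%:R =
    (4 ^+ q * q`!%:R) * (d%:R * (d ^ A)%:R) / 8 ^+ q :> R.
  by rewrite e8; field; rewrite !gt_eqF.
rewrite ler_pM2r ?invr_gt0 ?exprn_gt0 //.
apply: ler_pM; rewrite ?exprn_ge0 ?(ltW D_gt0) //; first exact: exprn_le_fact.
exact: scale_exp_le.
Qed.

Hypothesis l_ge5 : (5 <= l)%N.

Let root_k : (l <= k)%N := root_le l_root.

Definition phase_length : nat := (Num.truncn (4 * D / q%:R)).+1.
Local Notation m := phase_length.

(** The list starts with the phases of the levels [1, ..., k - l], the last ones in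
    time.  At these levels a phase shorter by the factor [q] suffices, which keeps
    the total length of these many phases comparable to the rest.  The other
    phases have length [q * phase_length], which lies between [4 * D] and
    [8 * D]. *)
Definition phases : seq nat :=
  nseq (k - l) m ++ nseq l (q * m)%N ++ [:: (q * m)%N].

Lemma size_phases : size phases = k.+1.
Proof. by rewrite !size_cat !size_nseq /= addn1 addnS subnK. Qed.

Lemma phases_gt0 : all (leq 1) phases.
Proof. by rewrite !all_cat !all_nseq /= !orbT. Qed.

Let phase_ge : 4 * D <= (q * m)%:R.
Proof.
rewrite natrM [leRHS]mulrC -ler_pdivrMr ?ltr0n // /phase_length; apply/ltW.
by rewrite -truncn_lt_nat // divr_ge0 // mulr_ge0 // ltW.
Qed.

Let scale_big : 2 ^+ (k - l) <= D.
Proof.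
apply: le_trans (scale_ge R d_ge2 l_root).
rewrite -natrX ler_nat leq_exp2r // subn_gt0.
by move: l_root l_ge5; nia.
Qed.

(* With [2 ^ (k - l) <= D] this gives [4 ^ q <= 4 * D], which makes the sampling
   errors of the short phases negligible. *)
Let double_root_le : (2 * q <= k - l + 2)%N.
Proof.
have := leq_mul (leqnn l) (l_ge5 : (6 <= l.+1)%N); move: l_root root_k.
move: (l * l.+1)%N (q * l.+2)%N => x y; lia.
Qed.

Let q_le_D : q%:R <= D.
Proof.
apply: le_trans scale_big; rewrite -natrX ler_nat.
by apply: leq_trans (ltnW (ltn_expl _ (isT : (1 < 2)%N))); lia.
Qed.

Let phase_le : (q * m)%:R <= 8 * D.
Proof.
rewrite natrM /phase_length -[(Num.truncn _).+1%:R]natr1 mulrDr mulr1.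
have := truncn_le (4 * D / q%:R); rewrite divr_ge0 ?mulr_ge0 ?(ltW D_gt0) // => h.
have q0 : 0 < q%:R :> R by rewrite ltr0n.
have := ler_wpM2l (ltW q0) h; rewrite mulrCA mulfV ?gt_eqF // mulr1.
have := q_le_D; have := D_gt0; lra.
Qed.

Lemma sumn_phases : (sumn phases)%:R <= 32 * (Num.sqrt k%:R * D).
Proof.
have -> : sumn phases = ((k - l + q * q) * m)%N.
  by rewrite !sumn_cat !sumn_nseq /=; lia.
have q_le : q%:R <= 2 * Num.sqrt k%:R :> R.
  have -> : 2 = Num.sqrt 4 :> R.
    have -> : (4 : R) = 2 ^+ 2 by rewrite -natrX.
    by rewrite sqrtr_sqr ger0_norm.
  rewrite -sqrtrM // -[leLHS](@ger0_norm R) // -sqrtr_sqr ler_sqrt ?mulr_ge0 //.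
  rewrite -natrX -natrM ler_nat; move: l_root l_ge5; nia.
apply: (@le_trans _ _ (2 * q%:R * (q * m)%:R)).
  by rewrite -!natrM ler_nat; move: k_le; nia.
have s0 : 0 <= Num.sqrt k%:R :> R := sqrtr_ge0 _.
have := phase_le; have := D_gt0; have q0 : 0 <= q%:R :> R by [].
set x := q%:R in q_le q0 *; set y := Num.sqrt _ in s0 q_le *; set z := (q * m)%:R.
move=> D0 zD; apply: (@le_trans _ _ (2 * (2 * y) * (8 * D))).
  by apply: ler_pM; rewrite ?mulr_ge0 // ler_pM2l.
by rewrite le_eqVlt; apply/orP; left; apply/eqP; ring.
Qed.

(** The ratio of level size to phase length is at most [q / 4] at level [k - l]
    and decreases geometrically below it, so the low levels amplify by at most
    [expR (q / 2) <= 2 ^ q].  At the high levels the inverse ratio, the expected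
    number of visits to a vertex in one phase, starts from at most [8] and
    decreases geometrically towards the leaves; replacing each [1 + d ^ i / M] by
    [d ^ i / M], where [M] is the phase length, therefore costs a factor of at
    most [expR 16], and the product becomes [d ^ A / M ^ l].  With the sampling
    errors, at most [q / M] in total, this gives [q * expR 16 / 4 ^ q].  The
    sampling errors of the low levels add [q ^ 3 / 4 ^ q], and [4 ^ q] beats
    [2 ^ q]. *)
Lemma loss_phases :
  loss R d k 0 phases <= (q%:R ^+ 3 + q%:R * expR 16) / 2 ^+ q.
Proof.
have m0 : (0 < m)%N by [].
have qm0 : (0 < q * m)%N by rewrite muln_gt0.
set M : R := (q * m)%:R.
have M0 : 0 < M by rewrite ltr0n.
have q0 : 0 < q%:R :> R by rewrite ltr0n.
have mE : m%:R = M / q%:R by rewrite /M natrM mulrAC mulfV ?mul1r ?gt_eqF.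
have mR : 0 < m%:R :> R by rewrite ltr0n.
have two : (0 : R) < 2 ^+ q by rewrite exprn_gt0.
have low : \prod_(i < k - l) (1 + (d ^ (0 + i).+1)%:R / m%:R) <= 2 ^+ q :> R.
  apply: le_trans (prod_1D_le_expR _ _) _ => [i _|]; first by rewrite divr_ge0.
  rewrite -mulr_suml -natr_sum.
  apply: (@le_trans _ _ (expR (q%:R * 2^-1))); last first.
    by rewrite expRM_natl lerXn2r ?nnegrE ?expR_ge0 // expR_half_le2.
  rewrite ler_expR ler_pdivrMr // mE (_ : q%:R * 2^-1 * (M / q%:R) = M / 2); last first.
    by field; rewrite gt_eqF.
  apply: (@le_trans _ _ (2 * (d ^ (k - l))%:R)).
    by rewrite -natrM ler_nat; exact: sum_expn_lt.
  have := phase_ge; have := scale_ge R d_ge2 l_root; rewrite -/M; lra.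
have high : \prod_(i < l) (1 + (d ^ (k - l + i).+1)%:R / M) <=
    (d ^ A)%:R / M ^+ l * expR 16.
  have dn j : (0 : R) < (d ^ j)%:R by rewrite ltr0n expn_gt0 ltnW.
  rewrite (eq_bigr (fun i : 'I_l => (d ^ (k - l + i).+1)%:R / M *
      (1 + M / (d ^ (k - l + i).+1)%:R))) => [|i _]; last first.
    by field; rewrite !gt_eqF.
  rewrite big_split /=; apply: ler_pM.
  - by apply: prodr_ge0 => i _; rewrite divr_ge0 // ltW.
  - by apply: prodr_ge0 => i _; rewrite addr_ge0 // divr_ge0 // ltW.
  - rewrite prodf_div prodr_const card_ord -natr_prod -expn_sum.
    rewrite (reindex_inj rev_ord_inj) /=.
    rewrite (eq_bigr (fun i : 'I_l => (k - i)%N)) // => i _.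
    by have := ltn_ord i; move: root_k; lia.
  apply: le_trans (prod_1D_le_expR _ _) _ => [i _|]; first by rewrite divr_ge0 // ltW.
  rewrite ler_expR.
  apply: (@le_trans _ _ (\sum_(i < l) 8 * ((d ^ i)%:R)^-1)).
    apply: ler_sum => i _; rewrite -addSn expnD natrM invfM mulrA.
    rewrite ler_wpM2r ?invr_ge0 // ler_pdivrMr //.
    have := phase_le; have := scale_le R d_ge2 l_root; rewrite -/M; lra.
  by rewrite -mulr_sumr; have := sum_exprVn_le R l d_ge2; lra.
have inner : loss R d k (0 + (k - l)) (nseq l (q * m)%N ++ [:: (q * m)%N]) <=
    q%:R * expR 16 / 4 ^+ q.
  rewrite add0n; apply: le_trans (loss_nseq_cat _ _ _ qm0 _) _; first by rewrite subnK.
  rewrite /= mulr0 addr0 -/M -[X in _ + X]mul1r -mulrDl natr1.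
  apply: (@le_trans _ _ ((d ^ A)%:R / M ^+ l * expR 16 * (q%:R / M))).
    by rewrite ler_wpM2r // divr_ge0 // ltW.
  have -> : (d ^ A)%:R / M ^+ l * expR 16 * (q%:R / M) =
      q%:R * expR 16 * ((d ^ A)%:R / M ^+ q).
    by rewrite exprS invfM; ring.
  rewrite ler_wpM2l ?mulr_ge0 ?expR_ge0 //.
  rewrite ler_pdivrMr ?exprn_gt0 // mulrC ler_pdivlMr ?exprn_gt0 //.
  apply: (@le_trans _ _ ((4 * D) ^+ q)).
    rewrite exprMn mulrC ler_pM2l ?exprn_gt0 //.
    exact: scale_exp_ge.
  by rewrite lerXn2r ?nnegrE ?mulr_ge0 ?(ltW D_gt0) ?(ltW M0).
apply: le_trans (loss_nseq_cat _ _ _ m0 _) _; first by rewrite add0n leq_subr.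
apply: (@le_trans _ _ (2 ^+ q * (q%:R ^+ 3 / 4 ^+ q + q%:R * expR 16 / 4 ^+ q))).
  have loss0 := loss_ge0 R d k.
  apply: ler_pM => //.
  - by apply: prodr_ge0 => i _; rewrite addr_ge0 // divr_ge0.
  - by rewrite addr_ge0 // divr_ge0.
  apply: lerD => //; rewrite mE invf_div mulrA ler_pdivrMr //.
  rewrite mulrAC ler_pdivlMr ?exprn_gt0 //.
  have kq : (k - l)%:R <= q%:R ^+ 2 :> R.
    by rewrite -natrX ler_nat; apply: leq_trans (leq_subr _ _) k_le.
  have M4 : 4 ^+ q <= M.
    apply: le_trans phase_ge.
    apply: (@le_trans _ _ (4 * 2 ^+ (k - l))); last by rewrite ler_pM2l.
    have -> : (4 : R) = 2 ^+ 2 by rewrite -natrX.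
    rewrite -exprM -exprD ler_eXn2l ?ltr1n //.
    by rewrite addnC; exact: double_root_le.
  apply: ler_pM => //; rewrite ?mulr_ge0 ?exprn_ge0 //.
  by rewrite [leRHS]exprSr ler_wpM2r.
have -> : (4 : R) ^+ q = 2 ^+ q * 2 ^+ q.
  by rewrite -exprMn; congr (_ ^+ _); rewrite -natrM.
by rewrite le_eqVlt; apply/orP; left; apply/eqP; field; rewrite gt_eqF.
Qed.

End Bounds.

(** * Concentration of the finish time *)

(** The expected number of chains is smallest at level [k - l], since [l + 1] is
    the integer nearest to [sqrt (2k+2)]. *)
Lemma triangular_root k : exists l, (l * l.+1 <= 2 * k < l.+1 * l.+2)%N.
Proof.
have ex0 : exists l, (l * l.+1 <= 2 * k)%N by exists 0%N.
have bnd l : (l * l.+1 <= 2 * k)%N -> (l <= 2 * k)%N by nia.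
case: (ex_maxnP ex0 bnd) => l lk lmax; exists l; rewrite lk /= ltnNge.
by apply/negP => /lmax; rewrite ltnn.
Qed.

Lemma expn4_le q : (16 <= q)%N -> (q ^ 4 <= 2 ^ q)%N.
Proof.
move=> q16; rewrite -(subnK q16); elim: (q - 16)%N => [//|n IH].
rewrite addSn [leqRHS]expnS; apply: leq_trans _ (leq_mul (leqnn 2) IH).
move: (n + 16)%N (leq_addl n 16) => m m16; rewrite !expnS expn0 !muln1.
have : (16 * (m * (m * m)) <= m * (m * (m * m)))%N by rewrite leq_mul2r m16 orbT.
have : (16 * (m * m) <= m * (m * m))%N by rewrite leq_mul2r m16 orbT.
have : (16 * m <= m * m)%N by rewrite leq_mul2r m16 orbT.
nia.
Qed.

Section Concentration.
Variable R : realType.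

Lemma finish_time_window (d k l : nat) (disp : measure_display)
    (T : measurableType disp) (P : probability T R)
    (C : nat * 'I_k -> T -> 'I_d) (a b : R) :
  (2 <= d)%N -> (l * l.+1 <= 2 * k < l.+1 * l.+2)%N -> (5 <= l)%N ->
  uniform_walks P C ->
  a <= growing_branching_time R d k / 8 ->
  32 * growing_branching_time R d k <= b ->
  1 - ((l.+1%:R ^+ 3 + l.+1%:R * expR 16) / 2 ^+ l.+1 + d%:R / 2 ^+ l.+1) <=
  fine (P [set x | a <= (dla_finish_time C x)%:R <= b]).
Proof.
move=> d2 lk l5 walksC aT bT.
have d0 : (0 < d)%N by exact: ltnW.
set G := [set x | _]; set T0 := growing_branching_time R d k in aT bT.
pose t := Num.truncn (T0 / 8); pose N := sumn (phases R d k l).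
have T0_ge0 : 0 <= T0 by rewrite mulr_ge0 ?sqrtr_ge0 ?powR_ge0.
pose S n := [set x | (dla_finish_time C x <= n)%N].
have mS n : measurable (S n) by exact: measurable_dla_finish_time_le d0 walksC n.
have mG : measurable G.
  exact: (measurable_dla_finish_time d0 walksC [set n : nat | a <= n%:R <= b]).
have sub : S N `<=` G `|` S t.
  move=> x /= xN; have [xt|tx] := leqP (dla_finish_time C x) t; [by right|left].
  apply/andP; split.
    apply: (le_trans aT); rewrite leNgt; apply/negP => /ltW.
    by rewrite -truncn_ge_nat ?divr_ge0 // leqNgt tx.
  apply: le_trans bT; apply: le_trans (sumn_phases R d2 lk l5).
  by rewrite ler_nat.
have PN : 1 - (l.+1%:R ^+ 3 + l.+1%:R * expR 16) / 2 ^+ l.+1 <= fine (P (S N)).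
  rewrite (dla_finish_time_le d0 walksC) /=.
  have := le_trans (source_unoccupied_le R d0 (size_phases R d lk)
    (phases_gt0 R d k l)) (loss_phases R d2 lk l5).
  rewrite -/N; set u := avgs _ _; set v := avgs _ _.
  suff -> : v = 1 - u by lra.
  rewrite -[1](avgs_cst (card_walks_gt0 k d0) N) -[u]mul1r -mulNr -avgsZ -avgsD.
  by apply: eq_avgs => s _; case: (_ \in _) => /=; ring.
have Pt : fine (P (S t)) <= d%:R / 2 ^+ l.+1.
  rewrite (dla_finish_time_le d0 walksC) /=.
  apply: le_trans (source_occupied_le R d0 t (root_le lk)) _.
  by apply: early_bound => //; have := truncn_le (T0 / 8); rewrite divr_ge0.
have fP A : measurable A -> P A \is a fin_num by move=> mA; exact: fin_num_measure.
have : (P (S N) <= P G + P (S t))%E.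
  apply: le_trans (measureU2 P mG (mS t)).
  by apply: le_measure; rewrite ?inE //; exact: measurableU.
move/fine_le; rewrite fineD ?fP // => le_fine.
by move: le_fine; rewrite fin_numD !fP // => /(_ isT isT); lra.
Qed.

(** The error is of order [q ^ 3 / 2 ^ q <= 1 / q] because [d <= k < q ^ 2]; this
    is where [d] must not grow too fast compared with [k]. *)
Lemma finish_time_concentrated (eps : R) : 0 < eps ->
  exists K, forall (d k : nat) (disp : measure_display)
    (T : measurableType disp) (P : probability T R)
    (C : nat * 'I_k -> T -> 'I_d) (a b : R),
  (K <= k)%N -> (2 <= d <= k)%N -> uniform_walks P C ->
  a <= growing_branching_time R d k / 8 ->
  32 * growing_branching_time R d k <= b ->
  1 - eps <= fine (P [set x | a <= (dla_finish_time C x)%:R <= b]).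
Proof.
move=> eps0; pose B : R := 2 + expR 16.
have B0 : 0 < B by rewrite addr_gt0 ?expR_gt0.
pose n := (Num.truncn (B / eps)).+1.
(* [k >= n ^ 2] forces [q >= n >= B / eps], and [k >= 256] forces [q >= 16]. *)
exists (maxn 256 (n ^ 2)) => d k disp T P C a b.
rewrite geq_max => /andP[k256 kn] /andP[d2 dk] walksC aT bT.
have [l lk] := triangular_root k.
have k_lt : (k < l.+1 ^ 2)%N by move: lk; nia.
have q16 : (16 <= l.+1)%N by rewrite -(@leq_exp2r _ _ 2) // (leq_trans k256 (ltnW k_lt)).
have nq : (n <= l.+1)%N by rewrite -(@leq_exp2r _ _ 2) // (leq_trans kn (ltnW k_lt)).
have l5 : (5 <= l)%N by lia.
apply: le_trans (finish_time_window d2 lk l5 walksC aT bT).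
rewrite lerD2l lerN2 -mulrDl.
set q : R := l.+1%:R.
have q0 : 0 < q by rewrite ltr0n.
have q1 : 1 <= q by rewrite ler1n.
have dq : d%:R <= q ^+ 3.
  by rewrite -natrX ler_nat (leq_trans dk) // (leq_trans (ltnW k_lt)) // leq_pexp2l.
have qq : q ^+ 4 <= 2 ^+ l.+1 by rewrite -!natrX ler_nat expn4_le.
apply: (@le_trans _ _ (B * q ^+ 3 / q ^+ 4)).
  apply: ler_pM => //.
  - by rewrite !addr_ge0 ?mulr_ge0 ?exprn_ge0 ?expR_ge0.
  - rewrite /B mulrDl; have := expR_ge0 (16 : R) => e0.
    have : q * expR 16 <= expR 16 * q ^+ 3.
      by rewrite mulrC ler_wpM2l // -[leLHS]expr1 ler_weXn2l.
    by lra.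
  - by rewrite lef_pV2 ?posrE ?exprn_gt0.
have -> : B * q ^+ 3 / q ^+ 4 = B / q by field; rewrite gt_eqF.
rewrite ler_pdivrMr // -ler_pdivrMl // mulrC.
apply: (@le_trans _ _ n%:R); last by rewrite ler_nat.
apply/ltW; rewrite -truncn_lt_nat // divr_ge0 // ltW //.
Qed.

End Concentration.

(** The exponents differ by [3/2 - (sqrt (2k+2) - sqrt (2k))], which lies in
    [[0, 3/2]]. *)
Lemma constant_le_growing (R : realType) b k : (2 <= b)%N ->
  constant_branching_time R b k <= growing_branching_time R b k.
Proof.
move=> b2; rewrite /constant_branching_time /growing_branching_time.
rewrite ler_wpM2l ?sqrtr_ge0 // ler_powR ?ler1n 1?ltnW //.
have s_ge0 : 0 <= Num.sqrt (2 * k%:R) :> R by exact: sqrtr_ge0.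
have := sqrtr_ge0 (2 * k%:R + 2 : R).
have : Num.sqrt (2 * k%:R) ^+ 2 = 2 * k%:R :> R by rewrite sqr_sqrtr // mulr_ge0.
have : Num.sqrt (2 * k%:R + 2) ^+ 2 = 2 * k%:R + 2 :> R.
  by rewrite sqr_sqrtr // addr_ge0 // mulr_ge0.
nra.
Qed.

Lemma growing_le_constant (R : realType) b k : (2 <= b)%N ->
  growing_branching_time R b k <= b%:R ^+ 2 * constant_branching_time R b k.
Proof.
move=> b2; rewrite /constant_branching_time /growing_branching_time.
rewrite mulrCA ler_wpM2l ?sqrtr_ge0 // -powR_mulrn // -powRD; last first.
  by rewrite pnatr_eq0 -lt0n ltnW ?implybT.
rewrite ler_powR ?ler1n 1?ltnW //.
suff : Num.sqrt (2 * k%:R) <= Num.sqrt (2 * k%:R + 2) :> R by lra.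
by rewrite ler_sqrt ?addr_ge0 ?mulr_ge0 // lerDl.
Qed.

Lemma window_cvg1 (R : realType) (d k : nat -> nat)
    (disp : nat -> measure_display) (T : forall m, measurableType (disp m))
    (P : forall m, probability (T m) R)
    (C : forall m, nat * 'I_(k m) -> T m -> 'I_(d m)) (a b : nat -> R) :
  (forall m, uniform_walks (P m) (C m)) -> k m @[m --> \oo] --> \oo ->
  (\forall m \near \oo, (2 <= d m <= k m)%N) ->
  (\forall m \near \oo, a m <= growing_branching_time R (d m) (k m) / 8) ->
  (\forall m \near \oo, 32 * growing_branching_time R (d m) (k m) <= b m) ->
  P m [set x | a m <= (dla_finish_time (C m) x)%:R <= b m]
    @[m --> \oo] --> 1%E.
Proof.
move=> walksC k_oo dk aT bT.
have mE m : (2 <= d m)%N -> measurable [set x | a m <= (dla_finish_time (C m) x)%:R <= b m].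
  move=> d2; exact: (measurable_dla_finish_time (ltnW d2) (walksC m)
    [set n : nat | a m <= n%:R <= b m]).
apply/fine_cvgP; split.
  near=> m; apply: fin_num_measure; apply: mE.
  by have /andP[] : (2 <= d m <= k m)%N by near: m.
apply/cvgrPdist_le => eps eps0.
have [K conc] := finish_time_concentrated eps0.
near=> m.
have dkm : (2 <= d m <= k m)%N by near: m.
have mEm : measurable [set x | a m <= (dla_finish_time (C m) x)%:R <= b m].
  by apply: mE; case/andP: dkm.
have le1 : fine (P m [set x | a m <= (dla_finish_time (C m) x)%:R <= b m]) <= 1.
  rewrite -lee_fin fineK; first exact: probability_le1.
  exact: fin_num_measure.
rewrite /= ger0_norm ?subr_ge0 // lerBlDr -lerBlDl.
apply: conc => //; near: m => //.
by move/cvgnyPge : k_oo; exact.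
Unshelve. all: by end_near.
Qed.

Theorem theorem2 (R : realType) (d k : nat -> nat)
    (disp : nat -> measure_display) (T : forall m, measurableType (disp m))
    (P : forall m, probability (T m) R)
    (C : forall m, nat * 'I_(k m) -> T m -> 'I_(d m))
    (om : nat -> R) :
  (forall m, uniform_walks (P m) (C m)) ->
  om n @[n --> \oo] --> +oo ->
  (d m @[m --> \oo] --> \oo -> k m @[m --> \oo] --> \oo ->
    (d m)%:R / (k m)%:R @[m --> \oo] --> (0 : R) ->
    let n m := (d m ^ k m)%N in
    let Tf m := growing_branching_time R (d m) (k m) in
    P m [set x | Tf m / om (n m) <= (dla_finish_time (C m) x)%:R
                                 <= om (n m) * Tf m]
      @[m --> \oo] --> 1%E)
  /\
  (forall b, (2 <= b)%N -> (forall m, d m = b) -> k m @[m --> \oo] --> \oo ->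
    let n m := (d m ^ k m)%N in
    let Tf m := constant_branching_time R (d m) (k m) in
    P m [set x | Tf m / om (n m) <= (dla_finish_time (C m) x)%:R
                                 <= om (n m) * Tf m]
      @[m --> \oo] --> 1%E).
Proof.
move=> walksC om_oo.
have om_ge B : k m @[m --> \oo] --> \oo -> (\forall m \near \oo, (2 <= d m)%N) ->
    \forall m \near \oo, B <= om (d m ^ k m)%N.
  move=> /cvgnyPge k_oo d2; move/cvgryPge : om_oo => /(_ B)[N _ omN].
  near=> m; apply: omN => /=; apply: (@leq_trans (k m)).
    by near: m; exact: k_oo.
  apply: leq_trans (ltnW (ltn_expl (k m) (isT : (1 < 2)%N))) _.
  have d2m : (2 <= d m)%N by near: m.
  by case: (k m) => // j; rewrite leq_exp2r.
have Tg_ge0 m : 0 <= growing_branching_time R (d m) (k m).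
  by rewrite mulr_ge0 ?sqrtr_ge0 ?powR_ge0.
have Tc_ge0 m : 0 <= constant_branching_time R (d m) (k m).
  by rewrite mulr_ge0 ?sqrtr_ge0 ?powR_ge0.
split=> [d_oo k_oo dk|b b2 db k_oo] n Tf; rewrite /n /Tf.
  have d2 : \forall m \near \oo, (2 <= d m)%N by move/cvgnyPge : d_oo; exact.
  have dk1 : \forall m \near \oo, (d m <= k m)%N.
    have k1 : \forall m \near \oo, (1 <= k m)%N by move/cvgnyPge : k_oo; exact.
    have dk1 : \forall m \near \oo, (d m)%:R / (k m)%:R < 1 :> R.
      by apply: (cvgr_lt 0 dk); exact: ltr01.
    near=> m; have : (d m)%:R / (k m)%:R < 1 :> R by near: m.
    rewrite ltr_pdivrMr ?mul1r ?ltr_nat ?ltr0n; first exact: ltnW.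
    by near: m.
  apply: window_cvg1 => //.
  - by near=> m; apply/andP; split; near: m.
  - near=> m; have om8 : 8 <= om (d m ^ k m)%N by near: m; exact: om_ge.
    by rewrite ler_wpM2l // lef_pV2 ?posrE // (lt_le_trans _ om8).
  - near=> m; have om32 : 32 <= om (d m ^ k m)%N by near: m; exact: om_ge.
    by rewrite ler_wpM2r.
have d2 : \forall m \near \oo, (2 <= d m)%N by near=> m; rewrite db.
apply: window_cvg1 => //.
- have kb : \forall m \near \oo, (b <= k m)%N by move/cvgnyPge : k_oo; exact.
  by near=> m; rewrite db b2 /=; near: m.
- near=> m; have om8 : 8 <= om (d m ^ k m)%N by near: m; exact: om_ge.
  apply: ler_pM => //; first by rewrite invr_ge0 (le_trans _ om8).
    by apply: constant_le_growing; rewrite db.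
  by rewrite lef_pV2 ?posrE // (lt_le_trans _ om8).
- near=> m.
  have omb : 32 * b%:R ^+ 2 <= om (d m ^ k m)%N by near: m; exact: om_ge.
  apply: (@le_trans _ _ (32 * (b%:R ^+ 2 * constant_branching_time R (d m) (k m)))).
    by rewrite ler_pM2l // -(db m) growing_le_constant ?db.
  by rewrite mulrA ler_wpM2r.
Unshelve. all: by end_near.
Qed.
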